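(* Let $\alpha$ be a partition with all parts $\ge2$, let $\pi$ be a permutation of $\{1,\dots,\ell(\alpha)\}$, let $\alpha_\pi$ be the corresponding rearrangement of the entries of $\alpha$, and let $R_{\alpha_\pi}$ be the connected ribbon with overlapping partition $p^\pi$. Let $\nu\in[\alpha,(|\alpha|-\ell(\alpha)+1,\ell(\alpha)-1)]$. If $c^\nu_{R_{\alpha_\pi}}>0$, then $$\nu_i\le\sum_{q=i}^{\ell(\alpha)}\alpha_q-p^\pi_i\quad\text{for }1\le i\le\ell(p^\pi).$$
   Context: A ribbon is a skew Young diagram (English convention) with no $2\times2$ square. For a composition $\beta$ with parts $\ge2$, the connected ribbon $R_\beta$ has rows from top to bottom of lengths $\beta_1,\dots,\beta_{\ell(\beta)}$, each pair of consecutive rows sharing exactly one column. Rows are ranked by length, ties being broken so that a lower row counts as smaller. The overlapping partition $p=(p_1,\dots,p_{\ell(\beta)-1},0)$ of $R_\beta$ has $p_i$ equal to the number of columns of length two both of whose boxes lie among the $\ell(\beta)-i+1$ smallest rows; $\ell(p)$ is its number of nonzero parts. For a skew shape $A$, $s_A=\sum_\nu c^\nu_As_\nu$ (Littlewood–Richardson coefficients). $[\lambda,\mu]$ is the interval in dominance order. *)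

(* Defs.v *)
From HB Require Import structures.
From mathcomp Require Import all_boot all_order all_fingroup all_algebra.
From mathcomp.multinomials Require Import mpoly.

Set Implicit Arguments.
Unset Strict Implicit.
Unset Printing Implicit Defensive.

Import GRing.Theory.

(* A partition is the weakly decreasing sequence of its positive parts. Parts, *)
(* rows, columns and tableau entries are indexed from 0; [nth 0 la i] is the   *)
(* (i+1)-st part, equal to 0 beyond the length.                                *)
Definition is_part (la : seq nat) : bool := sorted geq la && (0 \notin la).

(* The partitions of n with all parts <= m, grouped by the multiplicity k of   *)
(* the part m.                                                                 *)
Fixpoint partitions_le (m n : nat) : seq (seq nat) :=
  if m is m'.+1 then
    [seq nseq k m ++ la | k <- iota 0 (n %/ m).+1,
                          la <- partitions_le m' (n - k * m)]
  else if n == 0 then [:: [::]] else [::].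

Definition partitions (n : nat) : seq (seq nat) := partitions_le n n.

Definition dominates (mu la : seq nat) : Prop :=
  sumn la = sumn mu /\ forall k, sumn (take k la) <= sumn (take k mu).

Definition dom_interval (la mu nu : seq nat) : Prop :=
  [/\ is_part nu, dominates nu la & dominates mu nu].

(* English convention: the box (i, j) is in row i, counted from the top, and   *)
(* column j.                                                                   *)
Definition skew_diagram (la mu : seq nat) : seq (nat * nat) :=
  [seq (i, j) | i <- iota 0 (size la),
                j <- iota (nth 0 mu i) (nth 0 la i - nth 0 mu i)].

Definition young_diagram (la : seq nat) : seq (nat * nat) :=
  skew_diagram la [::].

Definition semistandard (n : nat) (D : seq (nat * nat))
    (T : {ffun seq_sub D -> 'I_n}) : bool :=
  [forall b, forall b',
    (((val b).1 == (val b').1) && ((val b).2 < (val b').2) ==> (T b <= T b'))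
    && (((val b).2 == (val b').2) && ((val b).1 < (val b').1)
         ==> (T b < T b'))].

(* The Schur function of the diagram D in n variables, with coefficients in    *)
(* the integers.                                                               *)
Definition schur (n : nat) (D : seq (nat * nat)) : {mpoly int[n]} :=
  (\sum_(T : {ffun seq_sub D -> 'I_n} | semistandard T)
     \prod_(b : seq_sub D) 'X_(T b))%R.

(* s_D = \sum_nu c nu s_nu as symmetric functions, i.e., in any number of      *)
(* variables. As the s_nu are linearly independent once n >= size D, this      *)
(* determines c on the partitions of size D.                                   *)
Definition LR_coefficients (D : seq (nat * nat)) (c : seq nat -> int) : Prop :=
  forall n : nat,
    (schur n D
     = \sum_(nu <- partitions (size D)) c nu *: schur n (young_diagram nu))%R.

(* Row i of the ribbon ends where the rows i, i+1, ... stacked with one-column *)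
(* overlaps end; row i starts in the last column of row i+1.                   *)
Definition ribbon_outer (be : seq nat) : seq nat :=
  [seq sumn (drop i be) - (size be - i.+1) | i <- iota 0 (size be)].

Definition ribbon_inner (be : seq nat) : seq nat :=
  [seq x.-1 | x <- behead (ribbon_outer be)].

Definition ribbon (be : seq nat) : seq (nat * nat) :=
  skew_diagram (ribbon_outer be) (ribbon_inner be).

Definition row_smaller (be : seq nat) (i k : nat) : bool :=
  (nth 0 be i < nth 0 be k) || ((nth 0 be i == nth 0 be k) && (k < i)).

Definition among_smallest (be : seq nat) (m i : nat) : bool :=
  count (fun k => row_smaller be k i) (iota 0 (size be)) < m.

Definition column (D : seq (nat * nat)) (j : nat) : seq (nat * nat) :=
  [seq b <- D | b.2 == j].

(* With i counted from 0, the size be - i smallest rows are the                *)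
(* l(be) - (i + 1) + 1 of the usual definition. The last entry is always 0.    *)
Definition overlapping_partition (be : seq nat) : seq nat :=
  [seq count (fun j => (size (column (ribbon be) j) == 2)
                && all (fun b => among_smallest be (size be - i) b.1)
                       (column (ribbon be) j))
             (undup [seq b.2 | b <- ribbon be])
  | i <- iota 0 (size be)].

Definition plength (p : seq nat) : nat := count (fun x => 0 < x) p.

Definition rearrange (al : seq nat) (pi : 'S_(size al)) : seq nat :=
  [seq nth 0 al (pi i) | i <- enum 'I_(size al)].
Arguments rearrange : clear implicits.

Lemma mem_partitions_le m n la :
  (la \in partitions_le m n)
  = [&& is_part la, all (fun x => x <= m) la & sumn la == n].
Proof.
elim: m n la => [|m IHm] n la.
  rewrite /=; case: la => [|x la] /=; first by case: n.
  rewrite /is_part /= in_cons negb_or.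
  by case: x => [|x]; case: n => [|n] //=; rewrite andbF.
apply/idP/idP.
  case/allpairsPdep => k [mu [+ + ->]].
  rewrite mem_iota add0n ltnS IHm leq_divRL // => kle.
  case/and3P => /andP [srt n0] /allP mule /eqP smu.
  apply/and3P; split.
  - apply/andP; split; last first.
      by rewrite mem_cat negb_or n0 andbT mem_nseq andbC.
    rewrite (sorted_pairwise (rev_trans leq_trans)) pairwise_cat.
    rewrite -!(sorted_pairwise (rev_trans leq_trans)) srt andbT; apply/andP; split.
      apply/allrelP => x y; rewrite mem_nseq => /andP [_ /eqP ->] /mule.
      by move/leqW.
    by elim: (k) => [|[|j] IHj] //=; rewrite leqnn.
  - apply/allP => x; rewrite mem_cat mem_nseq => /orP [/andP [_ /eqP ->] //|].
    by move/mule/leqW.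
  - by rewrite sumn_cat sumn_nseq smu mulnC subnKC // mulnC.
case/and3P => /andP [srt n0] /allP lale /eqP sla.
pose k := count_mem m.+1 la; pose mu := [seq x <- la | x <= m].
have Ela : la = nseq k m.+1 ++ mu.
  rewrite {}/k {}/mu; elim: la srt lale {n0 sla} => [|x la IHla] //= srt lale.
  have lale' y : y \in la -> y <= m.+1 by move=> yla; rewrite lale // inE yla orbT.
  have := IHla (path_sorted srt) lale' => Ela.
  have := lale x; rewrite inE eqxx leq_eqVlt ltnS => /(_ isT)/orP [/eqP xm|xm].
    by rewrite xm eqxx ltnn /= -Ela.
  have xle y : y \in la -> y <= m.
    move: srt; rewrite (path_sortedE (rev_trans leq_trans)) => /andP [/allP h _].
    by move/h => /= yx; apply: leq_trans yx xm.
  have Ec : count_mem m.+1 la = 0.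
    apply/eqP; rewrite -leqn0 leqNgt -has_count; apply/hasPn => y /xle ym.
    by rewrite /= neq_ltn ltnS ym.
  by rewrite xm ltn_eqF ?ltnS // Ec /= {1}Ela Ec.
have kmle : k * m.+1 <= n.
  by rewrite -sla Ela sumn_cat sumn_nseq mulnC leq_addr.
apply/allpairsPdep; exists k, mu; split=> //.
  by rewrite mem_iota add0n ltnS leq_divRL.
rewrite IHm; apply/and3P; split.
- rewrite /is_part mem_filter negb_and n0 orbT andbT.
  exact: (sorted_filter (rev_trans leq_trans)).
- by apply/allP => x; rewrite mem_filter => /andP [].
- by rewrite -sla Ela sumn_cat sumn_nseq mulnC addKn.
Qed.

Lemma mem_partitions n la :
  (la \in partitions n) = is_part la && (sumn la == n).
Proof.
rewrite /partitions mem_partitions_le; congr (_ && _).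
apply/andP/idP => [[] //|/eqP <-]; split=> //.
elim: la => //= x la IHla; rewrite leq_addr /=.
by apply: sub_all IHla => y /leq_trans; apply; rewrite leq_addl.
Qed.

Lemma uniq_partitions n : uniq (partitions n).
Proof.
rewrite /partitions; move: {1}n => m; elim: m n => [|m IHm] n; first by case: n.
apply: (@allpairs_uniq_dep _ (fun=> seq nat) _
  (fun k la => nseq k m.+1 ++ la)); first exact: iota_uniq.
  by move=> k _; apply: IHm.
have count_top k la : la \in partitions_le m (n - k * m.+1) ->
    count_mem m.+1 (nseq k m.+1 ++ la) = k.
  rewrite mem_partitions_le => /and3P [_ /allP le_m _].
  rewrite count_cat count_nseq /= eqxx mul1n -[RHS]addn0; congr addn.
  apply/eqP; rewrite -leqn0 leqNgt -has_count; apply/hasPn => y /le_m ym.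
  by rewrite /= neq_ltn ltnS ym.
move=> _ _ /allpairsPdep [k [la [_ la_m ->]]] /allpairsPdep [j [mu [_ mu_m ->]]].
move=> /= E.
have Ekj : k = j by rewrite -(count_top _ _ la_m) -(count_top _ _ mu_m) E.
subst j.
by move/eqP: E; rewrite eqseq_cat // eqxx => /eqP ->.
Qed.

(* Main.v *)
Require Import Defs.
From mathcomp Require Import all_boot all_order all_fingroup all_algebra.
From mathcomp Require Import zify.
From mathcomp.multinomials Require Import mpoly.

(* Let the size(al) - i shortest rows of the ribbon be the set S, and let the
   level of a row be the number of rows above it that are not in S. In a
   Littlewood-Richardson filling of the ribbon, the letters t + 1 in the rows up
   to k are at most as many as the letters t in the rows above k; going down the
   rows, this bounds the number nu_i of letters i (counted from 0) by the number
   of boxes of S whose letter equals the level of their row. Two boxes of S in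
   one column are on the same level and carry distinct letters, so each of the
   p_i columns of length two inside S contains a further box of S. Hence
   nu_i + p_i is at most the number of boxes of S.

   That c nu > 0 yields such a filling is Stembridge's argument. The functional
   f |-> sum_w sgn(w) [x^(w(nu + delta) - delta)] f, applied to a skew Schur
   function, is a signed count of tableaux. Cancel a tableau having a column
   tail {columns >= j} whose content is not a partition (j maximal) against the
   tableau obtained by a Bender-Knuth involution on the columns < j. There remain
   the tableaux of content nu all of whose column tails have partition
   content. For a Young diagram there is exactly one such tableau, filled by
   row indices, if its shape is nu, and none otherwise. *)

Set Implicit Arguments.
Unset Strict Implicit.
Unset Printing Implicit Defensive.

Import GRing.Theory.

(** * Bender-Knuth involutions on column prefixes *)

Section Mirror.

Variables (X : eqType) (s : seq X).
Hypothesis s_uniq : uniq s.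

(** Reversing a row of free cells and then exchanging the two letters turns a run of [p] letters [k]
    followed by [q] letters [k'] into [q] letters [k] followed by [p] letters [k'], which is the
    Bender-Knuth rule. *)
Definition mirror (x : X) : X := nth x (rev s) (index x s).

Lemma mem_mirror x : x \in s -> mirror x \in s.
Proof.
by move=> xs; rewrite /mirror -mem_rev mem_nth // size_rev index_mem.
Qed.

Lemma index_mirror x : x \in s -> index (mirror x) s = size s - (index x s).+1.
Proof.
move=> xs; have ix : index x s < size s by rewrite index_mem.
by rewrite /mirror nth_rev // index_uniq //; lia.
Qed.

Lemma mirrorK x : x \in s -> mirror (mirror x) = x.
Proof.
move=> xs; have ix : index x s < size s by rewrite index_mem.
rewrite {1}/mirror index_mirror // nth_rev; last by lia.
by rewrite (_ : _ - _ = index x s) ?nth_index //; lia.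
Qed.

End Mirror.

(** * Tableaux on an abstract set of cells with coordinates *)

Section Fillings.

Variables (X : finType) (rw cl : X -> nat).

(** Together with injectivity of the coordinates, this is all that the cancellation uses of a skew
    diagram. *)
Definition convex_cells : Prop := forall x z r c,
  rw x <= r <= rw z -> cl x <= c <= cl z -> exists2 y, rw y = r & cl y = c.

Definition ssyt n (T : {ffun X -> 'I_n}) : bool :=
  [forall b, forall b',
    ((rw b == rw b') && (cl b < cl b') ==> (T b <= T b'))
    && ((cl b == cl b') && (rw b < rw b') ==> (T b < T b'))].

Lemma ssytP n (T : {ffun X -> 'I_n}) :
  reflect ((forall x y, rw x = rw y -> cl x < cl y -> T x <= T y) /\
           (forall x y, cl x = cl y -> rw x < rw y -> T x < T y)) (ssyt T).
Proof.
apply: (iffP 'forall_forallP) => [h|[hr hc] x y].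
  split=> x y e l; have /andP[h1 h2] := h x y.
    by apply: (implyP h1); rewrite e eqxx.
  by apply: (implyP h2); rewrite e eqxx.
by apply/andP; split; apply/implyP => /andP[/eqP]; [exact: hr | exact: hc].
Qed.

Definition content n (T : {ffun X -> 'I_n}) (a : 'I_n) : nat :=
  #|[set x | T x == a]|.

Definition content_from n (j : nat) (T : {ffun X -> 'I_n}) (a : 'I_n) : nat :=
  #|[set x | (T x == a) && (j <= cl x)]|.

(** Imposed for every [j], this is the Littlewood-Richardson condition: columns increase strictly,
    so the reading word needs to be tested only where a column ends. *)
Definition lattice_from n (j : nat) (T : {ffun X -> 'I_n}) : bool :=
  [forall a : 'I_n, forall b : 'I_n,
    (b == a.+1 :> nat) ==> (content_from j T b <= content_from j T a)].

Section BenderKnuth.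

Hypothesis cell_inj : forall x y, rw x = rw y -> cl x = cl y -> x = y.
Hypothesis cell_convex : convex_cells.

Section Matching.

Variables (P : {set X}) (j : nat).

Definition partner (x : X) : option X :=
  [pick y | [&& y != x, cl y == cl x & y \in P]].

Definition free_cells (r : nat) : {set X} :=
  [set x in P | [&& cl x < j, rw x == r & partner x == None]].

Definition free_row (r : nat) : seq X :=
  sort (fun x y => cl x <= cl y) (enum (free_cells r)).

(** The Bender-Knuth move is this involution on cells followed by a transposition of letters. In a
    column holding both letters the two exchanges cancel; free cells are reflected within their
    row. *)
Definition match_cell (x : X) : X :=
  if (x \in P) && (cl x < j) then
    if partner x is Some y then y else mirror (free_row (rw x)) x
  else x.

Hypothesis two_per_column : forall x y z, x \in P -> y \in P -> z \in P ->
  cl x = cl y -> cl x = cl z -> y != x -> z != x -> y = z.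

Lemma partnerP x y : x \in P -> partner x = Some y ->
  [/\ y != x, cl y = cl x, y \in P & partner y = Some x].
Proof.
move=> xP; rewrite /partner; case: pickP => // z /and3P[zx /eqP czx zP] [<-].
split=> //; case: pickP => [t /and3P[tz /eqP ctz tP]|/(_ x)].
  by congr Some; apply: (two_per_column zP); rewrite // eq_sym.
by rewrite eq_sym zx czx eqxx xP.
Qed.

Lemma partner_none x y : partner x = None -> y \in P -> cl y = cl x -> y = x.
Proof.
rewrite /partner; case: pickP => // h _ yP cyx; apply/eqP.
by have := h y; rewrite cyx eqxx yP !andbT => /negbFE.
Qed.

Lemma mem_free_row r x : (x \in free_row r) = (x \in free_cells r).
Proof. by rewrite mem_sort mem_enum. Qed.

Lemma free_row_uniq r : uniq (free_row r).
Proof. by rewrite sort_uniq enum_uniq. Qed.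

Lemma free_row_index r x y : x \in free_cells r -> y \in free_cells r ->
  cl x < cl y -> index x (free_row r) < index y (free_row r).
Proof.
move=> xF yF lxy; rewrite ltnNge; apply/negP => lyx.
have tr : transitive (fun x y => cl x <= cl y).
  by move=> ? ? ?; apply: leq_trans.
have re : reflexive (fun x y => cl x <= cl y) by move=> ?; apply: leqnn.
have st : sorted (fun x y => cl x <= cl y) (free_row r).
  by apply: sort_sorted => ? ?; apply: leq_total.
have := sorted_leq_index tr re st; move=> /(_ y x); rewrite !mem_free_row.
by move=> /(_ yF xF lyx); rewrite leqNgt lxy.
Qed.

Lemma free_mirror r x : x \in free_cells r ->
  mirror (free_row r) x \in free_cells r.
Proof. by move=> xF; rewrite -mem_free_row mem_mirror // mem_free_row. Qed.

Lemma free_mirror_anti r x y : x \in free_cells r -> y \in free_cells r ->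
  cl x < cl y -> cl (mirror (free_row r) y) < cl (mirror (free_row r) x).
Proof.
move=> xF yF lxy; have ixy := free_row_index xF yF lxy.
have mxF := free_mirror xF; have myF := free_mirror yF.
have iy : index y (free_row r) < size (free_row r).
  by rewrite index_mem mem_free_row.
have lt_i : index (mirror (free_row r) y) (free_row r) <
            index (mirror (free_row r) x) (free_row r).
  rewrite !index_mirror ?free_row_uniq ?mem_free_row //.
  by apply: ltn_sub2l => //; exact: leq_ltn_trans ixy iy.
rewrite ltnNge leq_eqVlt; apply/negP => /orP[/eqP e|/(free_row_index mxF myF)].
  suff E : mirror (free_row r) x = mirror (free_row r) y.
    by rewrite E ltnn in lt_i.
  apply: cell_inj => //; move: mxF myF; rewrite !inE.
  by case/and4P=> _ _ /eqP-> _ /and4P[_ _ /eqP-> _].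
by lia.
Qed.

Lemma free_cellsE x : x \in P -> cl x < j -> partner x = None ->
  x \in free_cells (rw x).
Proof. by move=> xP xj px; rewrite !inE xP xj px !eqxx. Qed.

Lemma match_cell_mem x : x \in P -> cl x < j ->
  (match_cell x \in P) && (cl (match_cell x) < j).
Proof.
move=> xP xj; rewrite /match_cell xP xj /=.
case px: partner => [y|]; first by have [_ -> -> _] := partnerP xP px.
by have := free_mirror (free_cellsE xP xj px); rewrite !inE => /and4P[-> ->].
Qed.

Lemma match_cell_out x : ~~ ((x \in P) && (cl x < j)) -> match_cell x = x.
Proof. by move=> /negbTE h; rewrite /match_cell h. Qed.

Lemma match_cellK : involutive match_cell.
Proof.
move=> x; have [/andP[xP xj]|h] := boolP ((x \in P) && (cl x < j)); last first.
  by rewrite !match_cell_out.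
rewrite {1}/match_cell match_cell_mem // /match_cell xP xj /=.
case px: (partner x) => [y|]; first by have [_ _ _ ->] := partnerP xP px.
have xF := free_cellsE xP xj px; have := free_mirror xF.
rewrite !inE => /and4P[_ _ /eqP er /eqP ->]; rewrite er.
by rewrite mirrorK ?free_row_uniq ?mem_free_row.
Qed.

Lemma match_cell_lt x : (cl (match_cell x) < j) = (cl x < j).
Proof.
have [/andP[xP xj]|h] := boolP ((x \in P) && (cl x < j)).
  by have /andP[_ ->] := match_cell_mem xP xj.
by rewrite match_cell_out.
Qed.

End Matching.

Variable n : nat.
Implicit Type T : {ffun X -> 'I_n}.
Variables (j : nat) (k k' : 'I_n).
Hypothesis kS : k' = k.+1 :> nat.

Definition two_letters T : {set X} := [set x | (T x == k) || (T x == k')].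

Definition bender_knuth T : {ffun X -> 'I_n} :=
  [ffun x => if cl x < j then tperm k k' (T (match_cell (two_letters T) j x))
             else T x].

Lemma tperm_out a : (a == k) || (a == k') = false -> tperm k k' a = a.
Proof. by case: tpermP => // ->; rewrite eqxx ?orbT. Qed.

Lemma tperm_mem a :
  (tperm k k' a == k) || (tperm k k' a == k') = (a == k) || (a == k').
Proof.
by case: tpermP => [->|->|]; rewrite ?eqxx ?orbT //.
Qed.

Section OneTableau.

Variable T : {ffun X -> 'I_n}.
Hypothesis T_ssyt : ssyt T.

Let T_row : forall x y, rw x = rw y -> cl x < cl y -> T x <= T y.
Proof. by have /ssytP[] := T_ssyt. Qed.

Let T_col : forall x y, cl x = cl y -> rw x < rw y -> T x < T y.
Proof. by have /ssytP[] := T_ssyt. Qed.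

Lemma ssyt_col_inj x y : cl x = cl y -> T x = T y -> x = y.
Proof.
move=> c e; apply: cell_inj => //; have [l|l|//] := ltngtP (rw x) (rw y).
  by have := T_col c l; rewrite e ltnn.
by have := T_col (esym c) l; rewrite e ltnn.
Qed.

Let P := two_letters T.
Let PE x : (x \in P) = (T x == k) || (T x == k').
Proof. by rewrite inE. Qed.

Lemma two_letters_column x y z : x \in P -> y \in P -> z \in P ->
  cl x = cl y -> cl x = cl z -> y != x -> z != x -> y = z.
Proof.
rewrite !PE => hx hy hz cxy cxz nyx nzx.
have cyz : cl y = cl z by rewrite -cxy.
case/orP: hx hy hz => /eqP ex /orP[]/eqP ey /orP[]/eqP ez;
  solve [by apply: ssyt_col_inj; rewrite // ey ez |
    by case/eqP: nyx; apply: ssyt_col_inj; rewrite // ex ey |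
    by case/eqP: nzx; apply: ssyt_col_inj; rewrite // ex ez].
Qed.

Local Notation tau := (match_cell P j).

Lemma two_letters_bk : two_letters (bender_knuth T) = P.
Proof.
apply/setP => x; rewrite !inE ffunE; case: ifP => // xj; rewrite tperm_mem.
have [xP|xP] := boolP (x \in P); last first.
  by rewrite match_cell_out ?negb_and ?xP.
have /andP[+ _] := match_cell_mem two_letters_column xP xj.
by rewrite -/P !PE => ->; rewrite -PE.
Qed.

Lemma bender_knuthK : bender_knuth (bender_knuth T) = T.
Proof.
apply/ffunP => x; rewrite ffunE two_letters_bk; case: ifP => xj; last first.
  by rewrite ffunE xj.
rewrite ffunE match_cell_lt; last exact: two_letters_column.
by rewrite xj tpermK match_cellK //; exact: two_letters_column.
Qed.

Lemma bender_knuth_ge x : j <= cl x -> bender_knuth T x = T x.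
Proof. by move=> h; rewrite ffunE ltnNge h. Qed.

Lemma content_from_bk i : j <= i ->
  content_from i (bender_knuth T) =1 content_from i T.
Proof.
move=> ji a; rewrite /content_from; apply: eq_card => x.
rewrite !inE; have [ix|] := leqP i (cl x); rewrite ?andbF //.
by rewrite bender_knuth_ge // (leq_trans ji).
Qed.

Lemma content_split T' a : content T' a =
  content_from j T' a + #|[set x | (T' x == a) && (cl x < j)]|.
Proof.
rewrite /content /content_from -(cardsID [set x | j <= cl x]).
congr (_ + _); apply: eq_card => x; rewrite !inE //.
by rewrite ltnNge andbC.
Qed.

(** Reindexing the cells left of column [j] by the cell involution leaves only the transposition of
    the letters. *)
Lemma content_bk a : content (bender_knuth T) a =
  content_from j T a + #|[set x | (T x == tperm k k' a) && (cl x < j)]|.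
Proof.
rewrite content_split content_from_bk //; congr (_ + _).
have tauK := match_cellK j two_letters_column.
rewrite -(card_imset _ (can_inj tauK)); apply: eq_card => x.
apply/imsetP/idP => [[y + ->]|].
  rewrite !inE ffunE match_cell_lt; last exact: two_letters_column.
  by case: (cl y < j); rewrite ?andbF // !andbT => /eqP <-; rewrite tpermK.
rewrite inE => /andP[/eqP Tx xj]; exists (tau x); last by rewrite tauK.
rewrite inE ffunE match_cell_lt; last exact: two_letters_column.
by rewrite xj tauK Tx tpermK eqxx.
Qed.

Lemma bk_row_free x : x \in P -> cl x < j -> partner P x = None ->
  bender_knuth T x = tperm k k' (T (mirror (free_row P j (rw x)) x)).
Proof. by move=> xP xj px; rewrite ffunE xj /match_cell xP xj px. Qed.

Lemma bk_unchanged x : ~~ [&& x \in P, cl x < j & partner P x == None] ->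
  bender_knuth T x = T x.
Proof.
rewrite !negb_and; case: (boolP (x \in P)) => [xP|xP _] /=; last first.
  rewrite ffunE; case: ifP => // _.
  by rewrite match_cell_out ?negb_and ?xP // tperm_out // -PE; apply/negbTE.
rewrite -leqNgt; case: leqP => [jx _|xj /=]; first exact: bender_knuth_ge.
case px: (partner P x) => [y|] // _.
rewrite ffunE xj /match_cell xP xj px /=.
have [nyx cyx yP _] := partnerP two_letters_column xP px.
have nT : T y != T x.
  by apply: contra nyx => /eqP/(ssyt_col_inj cyx)/eqP.
move: xP yP nT; rewrite !PE => /orP[]/eqP-> /orP[]/eqP->; rewrite ?eqxx //.
  by rewrite tpermR.
by rewrite tpermL.
Qed.

Lemma bk_two_letters x : x \in P ->
  bender_knuth T x = k \/ bender_knuth T x = k'.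
Proof.
by rewrite -two_letters_bk inE => /orP[]/eqP->; [left|right].
Qed.

Hypothesis no_k : forall x, cl x = j -> T x != k.

Let cellP x z r c : rw x <= r <= rw z -> cl x <= c <= cl z ->
  exists2 y, rw y = r & cl y = c := @cell_convex x z r c.

(** Here [x] carries [k] too. If [y] is beyond the cut, the row of [x] crosses column [j] in a cell
    with letter [k], against [no_k]. If [y] has a partner [k'] below it, the cell in the column of
    [x] and the row of that partner carries [k'], so [x] would not be free. *)
Lemma left_of_matched x y : rw x = rw y -> cl x < cl y -> T y = k ->
  x \in P -> cl x < j -> partner P x = None ->
  ~~ [&& y \in P, cl y < j & partner P y == None] -> False.
Proof.
move=> rxy cxy Ty xP xj px.
have yP : y \in P by rewrite PE Ty eqxx.
have Tx : T x = k.
  move: xP; rewrite PE => /orP[/eqP//|/eqP Tx].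
  by have := T_row rxy cxy; rewrite Tx Ty kS ltnn.
rewrite yP /=; have [yj|jy _] := ltnP (cl y) j; last first.
  have [||z rz cz] := @cellP x y (rw x) j; [by lia | by lia |].
  have := no_k cz; rewrite -val_eqE eqn_leq negb_and /= => /orP[].
    have [e|ne] := eqVneq (cl y) j.
      by rewrite (_ : z = y) ?Ty ?leqnn //; apply: cell_inj; rewrite ?rz ?cz.
    rewrite -Ty T_row ?rz // cz; lia.
  by rewrite -Tx T_row ?rz ?cz.
case py: (partner P y) => [z|] // _.
have [nzy czy zP pz] := partnerP two_letters_column yP py.
have Tz : T z = k'.
  move: zP; rewrite PE => /orP[/eqP Tz|/eqP//].
  by case/eqP: nzy; apply: ssyt_col_inj; rewrite // Tz Ty.
have lyz : rw y < rw z.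
  rewrite ltnNge; apply/negP => h.
  have [e|ne] := eqVneq (rw z) (rw y).
    by case/eqP: nzy; apply: cell_inj.
  have : T z < T y by apply: T_col => //; lia.
  by rewrite Tz Ty kS; lia.
have [||t rt ct] := @cellP x z (rw z) (cl x); [by lia | by lia |].
have : T x < T t by apply: T_col => //; lia.
have : T t <= T z by apply: T_row => //; lia.
rewrite Tx Tz kS => h1 h2.
have Tt : T t = k' by apply/val_inj => /=; lia.
have tx : t = x.
  by apply: (@partner_none P x t px) => //; rewrite PE Tt eqxx orbT.
by move: rt; rewrite tx; lia.
Qed.

(** Dual to [left_of_matched]: the partner of [x] is a [k] above it, and it forces a [k] above [y].
    The cut does not interfere, since [x] lies left of [y]. *)
Lemma right_of_matched x y : rw x = rw y -> cl x < cl y -> T x = k' ->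
  y \in P -> cl y < j -> partner P y = None ->
  ~~ [&& x \in P, cl x < j & partner P x == None] -> False.
Proof.
move=> rxy cxy Tx yP yj py.
have xP : x \in P by rewrite PE Tx eqxx orbT.
have Ty : T y = k'.
  move: yP; rewrite PE => /orP[/eqP Ty|/eqP//].
  by have := T_row rxy cxy; rewrite Tx Ty kS ltnn.
rewrite xP (ltn_trans cxy yj) /=.
case px: (partner P x) => [z|] // _.
have [nzx czx zP pz] := partnerP two_letters_column xP px.
have Tz : T z = k.
  move: zP; rewrite PE => /orP[/eqP//|/eqP Tz].
  by case/eqP: nzx; apply: ssyt_col_inj; rewrite // Tz Tx.
have lzx : rw z < rw x.
  rewrite ltnNge; apply/negP => h.
  have [e|ne] := eqVneq (rw z) (rw x).
    by case/eqP: nzx; apply: cell_inj.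
  have : T x < T z by apply: T_col => //; lia.
  by rewrite Tx Tz kS; lia.
have [||t rt ct] := @cellP z y (rw z) (cl y); [by lia | by lia |].
have : T t < T y by apply: T_col => //; lia.
have : T z <= T t by apply: T_row => //; lia.
rewrite Ty Tz kS => h1 h2.
have Tt : T t = k by apply/val_inj => /=; lia.
have ty : t = y.
  by apply: (@partner_none P y t py) => //; rewrite PE Tt eqxx.
by move: rt; rewrite ty; lia.
Qed.

Lemma two_letters_between x y : x \in P -> y \notin P ->
  (T x <= T y -> forall a : 'I_n, (a == k) || (a == k') -> a < T y) /\
  (T y <= T x -> forall a : 'I_n, (a == k) || (a == k') -> T y < a).
Proof.
rewrite !PE negb_or -!val_eqE /= => hx hy.
by split=> h a; rewrite -!val_eqE /=; lia.
Qed.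

(** Against any other letter, [k] and [k'] compare alike, so only pairs within [P] matter. In a
    column such a pair is matched and stays fixed; in a row the mixed pairs are settled by the two
    preceding lemmas. *)
Lemma bk_ssyt : ssyt (bender_knuth T).
Proof.
have bkP x : x \in P -> (bender_knuth T x == k) || (bender_knuth T x == k').
  by case/bk_two_letters=> ->; rewrite eqxx ?orbT.
have bkN x : x \notin P -> bender_knuth T x = T x.
  by move=> h; apply: bk_unchanged; rewrite negb_and h.
apply/ssytP; split=> x y.
  move=> rxy cxy; have Txy := T_row rxy cxy.
  have [xP|xP] := boolP (x \in P); have [yP|yP] := boolP (y \in P); last first.
  - by rewrite !bkN.
  - rewrite (bkN x) //; apply: ltnW.
    by apply: (proj2 (two_letters_between yP xP)) => //; exact: bkP.
  - rewrite (bkN y) //; apply: ltnW.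
    by apply: (proj1 (two_letters_between xP yP)) => //; exact: bkP.
  have [/and3P[_ xj /eqP px]|hx] :=
      boolP [&& x \in P, cl x < j & partner P x == None];
  have [/and3P[_ yj /eqP py]|hy] :=
      boolP [&& y \in P, cl y < j & partner P y == None].
  (* Both cells are free: reflection reverses their order, and the transposition of the letters
     reverses it back. *)
  - rewrite !bk_row_free //; have xF := free_cellsE xP xj px.
    have := free_cellsE yP yj py; rewrite -rxy => yF.
    have mxF := free_mirror xF; have myF := free_mirror yF.
    set x' := mirror _ x in mxF *; set y' := mirror _ y in myF *.
    have : T y' <= T x'.
      apply: T_row; last exact: free_mirror_anti.
      move: mxF myF; rewrite !inE => /and4P[_ _ /eqP-> _].
      by case/and4P=> _ _ /eqP-> _.
    move: mxF myF; rewrite !inE => /andP[mx _] /andP[my _].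
    case/orP: mx => /eqP->; case/orP: my => /eqP->;
      by rewrite ?tpermL ?tpermR ?leqnn // kS; lia.
  - rewrite (bk_unchanged hy).
    have := yP; rewrite PE => /orP[/eqP Ty|/eqP Ty].
      by case: (left_of_matched rxy cxy Ty xP xj px hy).
    by rewrite Ty; case: (bk_two_letters xP) => ->; rewrite ?kS ?leqnn.
  - rewrite (bk_unchanged hx).
    have := xP; rewrite PE => /orP[/eqP Tx|/eqP Tx].
      by rewrite Tx; case: (bk_two_letters yP) => ->; rewrite ?kS ?leqnn.
    by case: (right_of_matched rxy cxy Tx yP yj py hx).
  - by rewrite !bk_unchanged.
move=> cxy rxy; have Txy := T_col cxy rxy.
have [xP|xP] := boolP (x \in P); have [yP|yP] := boolP (y \in P); last first.
- by rewrite !bkN.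
- rewrite (bkN x) //.
  by apply: (proj2 (two_letters_between yP xP)); [exact: ltnW | exact: bkP].
- rewrite (bkN y) //.
  by apply: (proj1 (two_letters_between xP yP)); [exact: ltnW | exact: bkP].
have nxy : x != y by apply/eqP => e; rewrite e ltnn in rxy.
rewrite !bk_unchanged //.
  rewrite !negb_and; apply/orP; right; apply/orP; right; apply/eqP => py.
  by case/eqP: nxy; apply: (partner_none py).
rewrite !negb_and; apply/orP; right; apply/orP; right; apply/eqP => px.
by case/eqP: nxy; apply/esym/(partner_none px).
Qed.

End OneTableau.

End BenderKnuth.

End Fillings.

(** * The sign-reversing involution *)

(** A strictly increasing self-map of ['I_n] lies above the identity; this applies to [w] and to its
    inverse. *)
Lemma perm_ord_mono n (w : 'S_n) :
  (forall a b : 'I_n, a < b -> w a < w b) -> w = 1%g.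
Proof.
have ge_id (f : 'I_n -> 'I_n) :
    (forall a b : 'I_n, a < b -> f a < f b) -> forall a : 'I_n, a <= f a.
  move=> f_mono [m mn]; elim: m mn => [|m IHm] mn //=.
  have mn' : m < n by exact: ltnW.
  exact: leq_ltn_trans (IHm mn') (f_mono (Ordinal mn') (Ordinal mn) (leqnn _)).
move=> w_mono; apply/permP => a; rewrite perm1; apply/val_inj/eqP => /=.
rewrite eqn_leq ge_id // andbT.
rewrite -{2}(permK w a); apply: (ge_id (w^-1)%g) => b c bc.
have [//|cb|/val_inj e] := ltngtP ((w^-1)%g b) ((w^-1)%g c).
  by have := w_mono _ _ cb; rewrite !permKV; lia.
by move: bc; rewrite -(permKV w b) e permKV ltnn.
Qed.

Section Cancellation.

Variables (X : finType) (rw cl : X -> nat).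
Hypothesis cell_inj : forall x y, rw x = rw y -> cl x = cl y -> x = y.
Hypothesis cell_convex : convex_cells rw cl.
Variables (n : nat) (nu : nat -> nat).
Implicit Type T : {ffun X -> 'I_n}.

Definition shifted T (a : 'I_n) : nat := content T a + (n - a.+1).

Definition rearranges T (w : 'S_n) : bool :=
  [forall a, shifted T a == nu (w a) + (n - (w a).+1)].

(** The contribution of the monomial of [T] to the alternating functional: the signed number of [w]
    carrying [nu + delta] to [content T + delta], with [delta = (n - 1, ..., 0)]. *)
Definition signed_match T : int :=
  (\sum_(w : 'S_n) (-1) ^+ w * (rearranges T w)%:R)%R.

(** The choice depends on [T] only through the content of the tail. The reflection preserves this
    content, so it picks the same pair again and is an involution. *)
Definition violation j T : option ('I_n * 'I_n) :=
  [pick p : 'I_n * 'I_n | (p.2 == p.1.+1 :> nat)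
     && (content_from cl j T p.1 < content_from cl j T p.2)].

Definition reflect_at j T : {ffun X -> 'I_n} :=
  if violation j T is Some p then bender_knuth rw cl j p.1 p.2 T else T.

Lemma eq_lattice_from i T T' :
  content_from cl i T =1 content_from cl i T' ->
  lattice_from cl i T = lattice_from cl i T'.
Proof.
by move=> e; apply: eq_forallb => a; apply: eq_forallb => b; rewrite !e.
Qed.

Lemma lattice_fromPn j T :
  ~~ lattice_from cl j T -> exists p, violation j T = Some p.
Proof.
move=> /forallPn[a /forallPn[b]]; rewrite negb_imply -ltnNge => hab.
rewrite /violation; case: pickP => [p _|/(_ (a, b))]; first by exists p.
by rewrite hab.
Qed.

Lemma content_from_step j T a : content_from cl j T a =
  content_from cl j.+1 T a + #|[set x | (T x == a) && (cl x == j)]|.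
Proof.
rewrite /content_from -(cardsID [set x | j < cl x]); congr (_ + _);
  by apply: eq_card => x; rewrite !inE; case: (T x == a) => //=; lia.
Qed.

Lemma column_le1 j T a : ssyt rw cl T ->
  #|[set x | (T x == a) && (cl x == j)]| <= 1.
Proof.
move=> T_ssyt; apply/card_le1_eqP => x y.
rewrite !inE => /andP[/eqP Tx /eqP cx] /andP[/eqP Ty /eqP cy].
by apply: (ssyt_col_inj cell_inj T_ssyt); rewrite ?cx ?Tx.
Qed.

(** The tail from column [j.+1] satisfies the inequality and column [j] holds each letter at most
    once. So the inequality can fail only by one, with [b] in column [j] and [a] absent from it; the
    absence is what [bk_ssyt] requires. *)
Lemma violation_shape j T a b : ssyt rw cl T -> lattice_from cl j.+1 T ->
  violation j T = Some (a, b) ->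
  [/\ b = a.+1 :> nat, content_from cl j T b = (content_from cl j T a).+1
    & forall x, cl x = j -> T x != a].
Proof.
move=> T_ssyt /forallP/(_ a)/forallP/(_ b); rewrite /violation.
case: pickP => // -[a' b'] /= /andP[/eqP ba lt_ab] + [ea eb].
rewrite ea eb in ba lt_ab *; rewrite ba eqxx /= => le_ba.
have := column_le1 j b T_ssyt; move: lt_ab.
rewrite (content_from_step j T a) (content_from_step j T b) => h1 h2.
have c0 : #|[set x | (T x == a) && (cl x == j)]| = 0 by lia.
split=> //; first by lia.
move=> x cx; apply/eqP => Tx; have /eqP := c0; rewrite cards_eq0 => /eqP/setP.
by move=> /(_ x); rewrite !inE Tx cx !eqxx.
Qed.

Lemma reflect_at_spec j T : ssyt rw cl T -> lattice_from cl j.+1 T ->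
  [/\ ssyt rw cl (reflect_at j T), reflect_at j (reflect_at j T) = T
    & forall i, j <= i ->
        content_from cl i (reflect_at j T) =1 content_from cl i T].
Proof.
move=> T_ssyt T_lat; case ev: (violation j T) => [[a b]|]; last first.
  have E : reflect_at j T = T by rewrite /reflect_at ev.
  by rewrite !E.
have [ba cb na] := violation_shape T_ssyt T_lat ev.
have E : reflect_at j T = bender_knuth rw cl j a b T by rewrite /reflect_at ev.
have ec i ji := content_from_bk rw cl a b T (i := i) (j := j) ji.
rewrite E; split; [exact: bk_ssyt | | exact: ec].
rewrite /reflect_at (_ : violation j _ = Some (a, b)).
  exact: bender_knuthK.
by rewrite -ev; apply: eq_pick => p; rewrite !ec.
Qed.

(** In the tail [b] occurs once more than [a], while the staircase entry of [b] is one less than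
    that of [a]. The shifted tail counts of [a] and [b] thus agree, and swapping the counts left of
    column [j] swaps the totals. *)
Lemma shifted_reflect j T a b c : ssyt rw cl T -> lattice_from cl j.+1 T ->
  violation j T = Some (a, b) ->
  shifted (reflect_at j T) c = shifted T (tperm a b c).
Proof.
move=> T_ssyt T_lat ev; have [ba cb na] := violation_shape T_ssyt T_lat ev.
rewrite /shifted /reflect_at ev content_bk // (content_split cl j T).
have bn := ltn_ord b.
set L := #|_|; move: L => L.
by case: tpermP => [->|->|_ _] //; lia.
Qed.

(** Multiplication by [tperm a b] matches the permutations counted for the two tableaux and reverses
    the sign. *)
Lemma signed_match_reflect j T : ssyt rw cl T -> lattice_from cl j.+1 T ->
  ~~ lattice_from cl j T ->
  (signed_match (reflect_at j T) = - signed_match T)%R.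
Proof.
move=> T_ssyt T_lat /lattice_fromPn[[a b] ev].
have [ba cb na] := violation_shape T_ssyt T_lat ev.
rewrite /signed_match (reindex_inj (mulgI (tperm a b))) -sumrN.
apply: eq_bigr => w _; rewrite odd_permM odd_tperm.
have -> : a != b by rewrite -val_eqE /= ba; lia.
rewrite signr_addb expr1 mulN1r mulNr; congr (- (_ * _%:R))%R.
congr nat_of_bool; apply/forallP/forallP => h c.
  have := h (tperm a b c).
  by rewrite (shifted_reflect _ T_ssyt T_lat ev) permM !tpermK.
by rewrite (shifted_reflect _ T_ssyt T_lat ev) permM; exact: h.
Qed.

Definition lattice_cols j m T : bool :=
  all (fun i => lattice_from cl i T) (iota j m).

Lemma lattice_cols_reflect j m T : ssyt rw cl T -> lattice_from cl j.+1 T ->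
  lattice_cols j.+1 m (reflect_at j T) = lattice_cols j.+1 m T.
Proof.
move=> T_ssyt T_lat; have [_ _ ec] := reflect_at_spec T_ssyt T_lat.
apply: eq_in_all => i; rewrite mem_iota => /andP[/ltnW ji _].
by apply: eq_lattice_from; apply: ec.
Qed.

Lemma sum_signed_match_violating j m :
  (\sum_(T | [&& ssyt rw cl T, lattice_cols j.+1 m.+1 T
              & ~~ lattice_from cl j T]) signed_match T = 0)%R.
Proof.
pose C := fun T : {ffun X -> 'I_n} => [&& ssyt rw cl T,
  lattice_cols j.+1 m.+1 T & ~~ lattice_from cl j T].
rewrite -[LHS]/(\sum_(T | C T) signed_match T)%R.
set S := (\sum_(T | C T) _)%R.
have CP T : C T -> [/\ ssyt rw cl T, lattice_from cl j.+1 T,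
    ~~ lattice_from cl j T & C (reflect_at j T)].
  rewrite /C => /and3P[T_ssyt hl hn].
  have T_lat : lattice_from cl j.+1 T by case/andP: hl.
  have [h1 _ ec] := reflect_at_spec T_ssyt T_lat.
  split=> //; rewrite h1 lattice_cols_reflect // hl /=.
  by rewrite (eq_lattice_from (ec j _)).
(* Over the integers this form of the cancellation does not require the reflection to be free of
   fixed points. *)
suff : (S = - S)%R by move=> h; apply/eqP; lia.
rewrite {1}/S (reindex_onto (reflect_at j) (reflect_at j)); last first.
  by move=> T /CP[h1 h2 _ _]; have [_ ->] := reflect_at_spec h1 h2.
rewrite /S -sumrN; apply: eq_big => [T|T].
  apply/andP/idP => [[/CP[h1 h2 _ h] /eqP e]|]; first by rewrite -e.
  by move=> /CP[h1 h2 _ h]; have [_ -> _] := reflect_at_spec h1 h2.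
move=> /andP[/CP[h1 h2 _ h] /eqP e]; rewrite e in h.
by have [g1 g2 g3 _] := CP _ h; rewrite signed_match_reflect.
Qed.

(** Columns are treated from right to left. The tail from column [J] is empty; each step discards
    the tableaux whose rightmost violation is in the new column, and these sum to zero. *)
Lemma sum_signed_match_cols m J : (forall x, cl x < J) -> m <= J ->
  (\sum_(T | ssyt rw cl T) signed_match T =
   \sum_(T | ssyt rw cl T && lattice_cols (J - m) m.+1 T) signed_match T)%R.
Proof.
move=> cJ; elim: m => [|m IHm] mJ.
  apply: eq_bigl => T; rewrite subn0 /lattice_cols /= andbT.
  suff -> : lattice_from cl J T by rewrite andbT.
  apply/'forall_forallP => a b; apply/implyP => _.
  rewrite /content_from (_ : [set x | _] = set0) ?cards0 //.
  by apply/setP => x; rewrite !inE leqNgt cJ andbF.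
rewrite IHm ?(ltnW mJ) //.
rewrite (_ : J - m = (J - m.+1).+1); last by lia.
rewrite (bigID (lattice_from cl (J - m.+1))) /=.
rewrite [X in (_ + X)%R](_ : _ = 0)%R ?addr0; last first.
  rewrite -[RHS](sum_signed_match_violating (J - m.+1) m).
  by apply: eq_bigl => T; rewrite -andbA.
by apply: eq_bigl => T; rewrite -andbA [_ && lattice_from _ _ _]andbC.
Qed.

Hypothesis nu_anti : forall a b, a <= b -> nu b <= nu a.

Definition lr_filling T : bool :=
  ssyt rw cl T && [forall a : 'I_n, content T a == nu a].

(* A tableau all of whose column tails have partition content contributes only
   through the identity permutation, as both shifted sequences strictly
   decrease. *)
Lemma signed_match_lattice T : lattice_from cl 0 T ->
  signed_match T = [forall a : 'I_n, content T a == nu a]%:R%R.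
Proof.
move=> T_lat; have T_anti (a b : 'I_n) : a <= b -> content T b <= content T a.
  have e c : content T c = content_from cl 0 T c.
    by apply: eq_card => x; rewrite !inE andbT.
  case: b => b bn /=; elim: b bn => [|b IHb] bn.
    by rewrite leqn0 => /eqP a0; rewrite (_ : a = Ordinal bn) //; apply/val_inj.
  rewrite leq_eqVlt => /orP[/eqP ab|].
    by rewrite (_ : a = Ordinal bn) //; apply/val_inj.
  rewrite ltnS => ab; apply: leq_trans (IHb (ltnW bn) ab).
  have /forallP/(_ (Ordinal (ltnW bn)))/forallP/(_ (Ordinal bn)) := T_lat.
  by rewrite eqxx /= !e.
have only1 w : rearranges T w -> w = 1%g.
  move=> /forallP h; apply: perm_ord_mono => a b ab.
  have /eqP := h a; have /eqP := h b; rewrite /shifted => hb ha.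
  have := T_anti a b (ltnW ab); have bn := ltn_ord b => hab.
  rewrite ltnNge; apply/negP => wba; have := nu_anti wba.
  by have := ltn_ord (w a); lia.
rewrite /signed_match (bigD1 1%g) //= odd_perm1 expr0 mul1r big1 ?addr0.
  congr (_%:R)%R; congr nat_of_bool; apply: eq_forallb => a.
  by rewrite /shifted perm1 eqn_add2r.
move=> w w1; have [/only1 e|] := boolP (rearranges T w); last by rewrite mulr0.
by rewrite e eqxx in w1.
Qed.

Lemma sum_signed_match J : (forall x, cl x < J) ->
  (\sum_(T | ssyt rw cl T) signed_match T =
   #|[set T | lr_filling T && lattice_cols 0 J.+1 T]|%:R)%R.
Proof.
move=> cJ; rewrite (sum_signed_match_cols cJ (leqnn J)) subnn.
rewrite (bigID (fun T => [forall a : 'I_n, content T a == nu a])) /=.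
rewrite [X in (_ + X)%R]big1 ?addr0 => [|T /andP[/andP[_ /andP[T0 _]] hn]].
  rewrite -sum1_card natr_sum; apply: eq_big => [T|T].
    by rewrite inE /lr_filling andbAC.
  by move=> /andP[/andP[_ /andP[T0 _]] hn]; rewrite signed_match_lattice ?hn.
by rewrite signed_match_lattice // (negbTE hn).
Qed.
End Cancellation.

(** * Row form of the lattice condition *)

Section RowLattice.

Variables (X : finType) (rw cl : X -> nat).
Hypothesis cell_inj : forall x y, rw x = rw y -> cl x = cl y -> x = y.
Hypothesis cell_convex : convex_cells rw cl.
Variables (n : nat) (T : {ffun X -> 'I_n}).
Hypothesis T_ssyt : ssyt rw cl T.

Definition count_above (t k : nat) : nat :=
  #|[set x | (T x == t :> nat) && (rw x < k)]|.

Hypothesis T_lattice : forall x, lattice_from cl (cl x) T.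

(* Cut at the column of the leftmost letter t + 1 of row k: the tail contains
   every letter t + 1 of the rows up to k, but no letter t from row k on. *)
Lemma count_above_lattice t k : count_above t.+1 k.+1 <= count_above t k.
Proof.
have /ssytP[T_row T_col] := T_ssyt.
pose Q k := [pred x | (T x == t.+1 :> nat) && (rw x == k)].
have with_letter m x : Q m x -> count_above t.+1 m.+1 <= count_above t m.
  move=> Qx; case: (arg_minnP cl Qx) => y /andP[/eqP Ty /eqP ry] y_min.
  have [t1n tn] : t.+1 < n /\ t < n by have := ltn_ord (T y); rewrite Ty; lia.
  have /forallP/(_ (Ordinal tn))/forallP/(_ (Ordinal t1n)) := T_lattice y.
  rewrite eqxx /= => le_tail; apply: leq_trans (leq_trans le_tail _).
    apply/subset_leq_card/subsetP => z; rewrite !inE -val_eqE /=.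
    move=> /andP[/eqP Tz rz]; rewrite Tz eqxx /=.
    have [//|czy] := leqP (cl y) (cl z).
    have [rzm|nzm] := eqVneq (rw z) m.
      by have := y_min z; rewrite /Q /= Tz rzm !eqxx leqNgt czy => /(_ isT).
    have [||u ru cu] := @cell_convex z y m (cl z); [by lia | by lia |].
    have : T z < T u by apply: T_col; lia.
    have : T u <= T y by apply: T_row; lia.
    by lia.
  apply/subset_leq_card/subsetP => z; rewrite !inE -val_eqE /=.
  move=> /andP[/eqP Tz cyz]; rewrite Tz eqxx /= ltnNge; apply/negP => mz.
  have [||u ru cu] := @cell_convex y z m (cl z); [by lia | by lia |].
  have le_yu : T y <= T u.
    have [e|ne] := eqVneq (cl y) (cl z).
      by rewrite (cell_inj (_ : rw y = rw u) (_ : cl y = cl u)) //; lia.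
    by apply: T_row; lia.
  have : T u <= T z.
    have [e|ne] := eqVneq (rw z) m.
      by rewrite (cell_inj (_ : rw u = rw z) (_ : cl u = cl z)) //; lia.
    by apply/ltnW/T_col; lia.
  by lia.
have without_letter m : (forall x, ~~ Q m x) ->
    count_above t.+1 m.+1 = count_above t.+1 m.
  move=> none; apply: eq_card => x; rewrite !inE.
  by have := none x; rewrite /Q /=; case: (_ == t.+1) => //=; lia.
elim: k => [|k IHk].
  have [x /with_letter //|none] := pickP (Q 0).
  rewrite without_letter => [|x]; last by rewrite none.
  rewrite /count_above (_ : [set x | _] = set0) ?cards0 //.
  by apply/setP => x; rewrite !inE andbF.
have [x /with_letter //|none] := pickP (Q k.+1).
rewrite without_letter => [|x]; last by rewrite none.
apply: leq_trans IHk _; apply/subset_leq_card/subsetP => x; rewrite !inE.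
by case/andP=> -> /= /ltnW.
Qed.

(** Iterating [count_above_lattice] lowers the letter and the row bound together, down to the empty
    set of rows above row 0. *)
Lemma entry_le_row x : T x <= rw x.
Proof.
rewrite leqNgt; apply/negP => lt_xT.
have none t k : k <= t -> count_above t k = 0.
  elim: t k => [|t IHt] [|k] // kt; rewrite /count_above.
  - by apply/eqP; rewrite cards_eq0; apply/eqP/setP => y; rewrite !inE andbF.
  - by apply/eqP; rewrite cards_eq0; apply/eqP/setP => y; rewrite !inE andbF.
  - by apply/eqP; rewrite -leqn0 -(IHt k kt); exact: count_above_lattice.
have /eqP := none (T x) (rw x).+1 lt_xT; rewrite cards_eq0 => /eqP/setP/(_ x).
by rewrite !inE eqxx ltnSn.
Qed.

(** * Levels of rows relative to a set of rows *)

Section Levels.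

Variable S : pred nat.

Definition level (k : nat) : nat := count (predC S) (iota 0 k).

Lemma levelS k : level k.+1 = level k + ~~ S k.
Proof. by rewrite /level -addn1 iotaD count_cat /= addn0. Qed.

(** A row outside [S] raises the level by one, and [count_above_lattice] absorbs it. A row in [S]
    keeps the level and adds to both sides its boxes whose letter is that level. *)
Lemma count_above_level k : count_above (level k) k <=
  #|[set x | [&& S (rw x), rw x < k & T x == level (rw x) :> nat]]|.
Proof.
elim: k => [|k IHk].
  rewrite /count_above (_ : [set x | _] = set0) ?cards0 //.
  by apply/setP => x; rewrite !inE andbF.
rewrite levelS; have [Sk|nSk] := boolP (S k); rewrite ?addn0 ?addn1; last first.
  apply: leq_trans (count_above_lattice _ _) (leq_trans IHk _).
  apply/subset_leq_card/subsetP => x; rewrite !inE.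
  by case/and3P=> -> xk ->; rewrite andbT ltnW.
rewrite /count_above -(cardsID [set x | rw x < k]).
rewrite -[leqRHS](cardsID [set x | rw x < k]); apply: leq_add.
  rewrite (_ : _ :&: _ = [set x | (T x == level k :> nat) && (rw x < k)]).
    apply: leq_trans IHk _; apply/subset_leq_card/subsetP => x; rewrite !inE.
    by case/and3P=> -> xk ->; rewrite xk ltnW.
  by apply/setP => x; rewrite !inE; case: (_ == level k) => //=; lia.
apply/subset_leq_card/subsetP => x; rewrite !inE => /and3P[xk Tx xk'].
have -> : rw x = k by lia.
by rewrite Sk ltnn ltnSn Tx.
Qed.

End Levels.

End RowLattice.

(** * The alternating coefficient functional *)

Section Functional.

Variables (n : nat) (nu : nat -> nat).

Definition staircase : 'X_{1..n} := [multinom n - a.+1 | a < n].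

Definition shifted_perm (w : 'S_n) : 'X_{1..n} :=
  [multinom nu (w a) + (n - (w a).+1) | a < n].

(** Multiplying by the staircase monomial replaces the exponent [w(nu + delta) - delta], which may
    have negative entries, by a natural one. *)
Definition schur_coef (p : {mpoly int[n]}) : int :=
  (\sum_(w : 'S_n) (-1) ^+ w * (p * 'X_[staircase])@_(shifted_perm w))%R.

Lemma schur_coef_sum (I : Type) (r : seq I) (c : I -> int)
    (p : I -> {mpoly int[n]}) :
  (schur_coef (\sum_(i <- r) c i *: p i) =
   \sum_(i <- r) c i * schur_coef (p i))%R.
Proof.
rewrite /schur_coef; under [RHS]eq_bigr do rewrite mulr_sumr.
rewrite exchange_big; apply: eq_bigr => w _ /=.
rewrite mulr_suml raddf_sum mulr_sumr /=; apply: eq_bigr => i _.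
by rewrite -scalerAl mcoeffZ mulrCA.
Qed.

(** The monomial of [T] times the staircase monomial has exponent [shifted T], so its coefficient is
    the indicator of [rearranges]. *)
Lemma schur_coef_schur D : schur_coef (schur n D) =
  (\sum_(T : {ffun seq_sub D -> 'I_n} |
      ssyt (fun b => (val b).1) (fun b => (val b).2) T) signed_match nu T)%R.
Proof.
rewrite /schur_coef /signed_match exchange_big; apply: eq_bigr => w _ /=.
rewrite /schur mulr_suml raddf_sum mulr_sumr /=; apply: eq_bigr => T _.
rewrite -(big_morph (fun m => 'X_[m] : {mpoly int[n]})%R
  (@mpolyXD n int) (@mpolyX0 n int)) -mpolyXD mcoeffX.
congr (_ * _%:R)%R; congr nat_of_bool; apply/eqP/forallP => [h a|h].
  have := congr1 (fun m : 'X_{1..n} => m a) h.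
  rewrite mnmDE mnm_sumE !mnmE => <-; rewrite /shifted eqn_add2r /content.
  rewrite -sum1dep_card big_mkcond; apply/eqP; apply: eq_bigr => b _.
  by rewrite mnm1E; case: eqP.
apply/mnmP => a; rewrite mnmDE mnm_sumE !mnmE -(eqP (h a)) /shifted /content.
congr addn; rewrite -sum1dep_card [RHS]big_mkcond; apply: eq_bigr => b _.
by rewrite mnm1E; case: eqP.
Qed.

End Functional.

(** * Littlewood-Richardson fillings of diagrams *)

Definition cell_row (D : seq (nat * nat)) (b : seq_sub D) : nat := (val b).1.
Definition cell_col (D : seq (nat * nat)) (b : seq_sub D) : nat := (val b).2.

Lemma cell_coord_inj D (x y : seq_sub D) :
  cell_row x = cell_row y -> cell_col x = cell_col y -> x = y.
Proof.
rewrite /cell_row /cell_col; move=> er ec; apply: val_inj.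
by rewrite (surjective_pairing (val x)) er ec -surjective_pairing.
Qed.

Lemma mem_skew_diagram la mu i j : ((i, j) \in skew_diagram la mu) =
  (i < size la) && (nth 0 mu i <= j < nth 0 la i).
Proof.
apply/allpairsPdep/idP => [[r [k [+ + [-> ->]]]]|h].
  by rewrite !mem_iota; lia.
by exists i, j; rewrite !mem_iota; split=> //; lia.
Qed.

Lemma skew_diagram_uniq la mu : uniq (skew_diagram la mu).
Proof.
apply: (@allpairs_uniq_dep _ (fun=> nat) _ (fun i j => (i, j))).
- exact: iota_uniq.
- by move=> ? _; exact: iota_uniq.
- by move=> [i j] [i' j'] _ _ /= [-> ->].
Qed.

Lemma skew_diagram_convex la mu :
  (forall a b, a <= b -> nth 0 la b <= nth 0 la a) ->
  (forall a b, a <= b -> nth 0 mu b <= nth 0 mu a) ->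
  convex_cells (@cell_row (skew_diagram la mu)) (@cell_col _).
Proof.
move=> la_anti mu_anti [[rx cx] /= hx] [[rz cz] /= hz] r c.
rewrite /cell_row /cell_col /= => /andP[xr rz'] /andP[xc cz'].
suff h : (r, c) \in skew_diagram la mu by exists (SeqSub h).
move: hx hz; rewrite !mem_skew_diagram.
by have := la_anti _ _ rz'; have := mu_anti _ _ xr; lia.
Qed.

Lemma card_cells (D : seq (nat * nat)) (p : pred (nat * nat)) : uniq D ->
  #|[set b : seq_sub D | p (val b)]| = count p D.
Proof.
move=> D_uniq; rewrite cardE -(size_map val) -size_filter.
apply/perm_size/uniq_perm; rewrite ?filter_uniq //.
  by rewrite map_inj_uniq ?enum_uniq //; exact: val_inj.
move=> b; rewrite mem_filter; apply/mapP/andP => [[x + ->]|[pb bD]].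
  by rewrite mem_enum inE => px; rewrite px (valP x).
by exists (SeqSub bD); rewrite // mem_enum inE.
Qed.

Lemma count_rows (q : pred nat) la mu :
  count (fun b => q b.1) (skew_diagram la mu) =
  \sum_(r <- iota 0 (size la) | q r) (nth 0 la r - nth 0 mu r).
Proof.
rewrite /skew_diagram count_flatten -map_comp sumnE big_map [RHS]big_mkcond /=.
apply: eq_bigr => r _; rewrite count_map /preim /=.
by case: (q r); rewrite ?count_predT ?count_pred0 ?size_iota.
Qed.

Lemma count_row la mu a :
  count (fun b => b.1 == a) (skew_diagram la mu) = nth 0 la a - nth 0 mu a.
Proof.
rewrite (count_rows (pred1 a)).
have [al|la_a] := ltnP a (size la).
  by rewrite -big_filter filter_pred1_uniq ?big_seq1 ?iota_uniq ?mem_iota.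
rewrite (nth_default _ la_a) sub0n big_seq_cond big1 // => r.
by rewrite mem_iota => /andP[+ /eqP]; lia.
Qed.

Section LRFillings.

Variables (n : nat) (nu : nat -> nat).
Hypothesis nu_anti : forall a b, a <= b -> nu b <= nu a.

Lemma schur_coefP D : convex_cells (@cell_row D) (@cell_col D) ->
  schur_coef nu (schur n D) != 0%R <->
  exists T : {ffun seq_sub D -> 'I_n},
    lr_filling (@cell_row D) (@cell_col D) nu T
    /\ forall j, lattice_from (@cell_col D) j T.
Proof.
move=> D_convex; pose J := (\max_(b : seq_sub D) cell_col b).+1.
have bJ b : @cell_col D b < J by rewrite ltnS; exact: leq_bigmax.
rewrite schur_coef_schur.
rewrite -/(@cell_row D) -/(@cell_col D).
rewrite (sum_signed_match (@cell_coord_inj D) D_convex n nu_anti bJ).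
rewrite Num.Theory.pnatr_eq0 cards_eq0; split.
  case/set0Pn => T; rewrite inE => /andP[T_lr T_cols]; exists T; split=> // j.
  have [jJ|Jj] := leqP j J.
    by apply: (allP T_cols); rewrite mem_iota; lia.
  (* No cell lies beyond column [J], so both contents vanish. *)
  apply/'forall_forallP => a b; apply/implyP => _.
  rewrite /content_from (_ : [set x | _] = set0) ?cards0 //.
  apply/setP => x; rewrite !inE; have := bJ x.
  by case: (T x == b) => //=; lia.
case=> T [T_lr T_lat]; apply/set0Pn; exists T; rewrite inE T_lr.
by apply/allP => j _.
Qed.

End LRFillings.

Lemma is_part_anti la : is_part la ->
  forall a b, a <= b -> nth 0 la b <= nth 0 la a.
Proof.
case/andP=> la_sorted _ a b ab.
have [bl|/(nth_default _)-> //] := ltnP b (size la).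
apply: (sorted_leq_nth (rev_trans leq_trans) leqnn 0 la_sorted) => //.
by rewrite inE; lia.
Qed.

Lemma is_part_gt0 la a : is_part la -> a < size la -> 0 < nth 0 la a.
Proof.
case/andP=> _ n0 al; rewrite lt0n; apply: contra n0 => /eqP <-.
exact: mem_nth.
Qed.

Lemma is_part_size la : is_part la -> size la <= sumn la.
Proof.
case/andP=> _; elim: la => //= x la IHla.
rewrite inE negb_or => /andP[x0 /IHla].
by case: x x0 => // x _; lia.
Qed.

Lemma eq_part n la mu : is_part la -> is_part mu ->
  size la <= n -> size mu <= n ->
  (forall a, a < n -> nth 0 la a = nth 0 mu a) -> la = mu.
Proof.
move=> la_part mu_part lan mun e.
have se : size la = size mu.
  case: (ltngtP (size la) (size mu)) => // h.
    have := is_part_gt0 mu_part h; rewrite -e ?nth_default //; lia.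
  have := is_part_gt0 la_part h; rewrite e ?nth_default //; lia.
by apply: (@eq_from_nth _ 0) => // a al; apply: e; lia.
Qed.

Lemma nth0_nil a : nth 0 [::] a = 0. Proof. by rewrite nth_nil. Qed.

Lemma young_convex la : is_part la ->
  convex_cells (@cell_row (young_diagram la)) (@cell_col _).
Proof.
move=> la_part; apply: skew_diagram_convex; first exact: is_part_anti.
by move=> a b _; rewrite !nth0_nil.
Qed.

(** * The functional on Schur functions of partitions *)

Section YoungDiagram.

Variables (n : nat) (la : seq nat).
Hypotheses (la_part : is_part la) (la_n : size la <= n).

Local Notation D := (young_diagram la).

Lemma mem_young_diagram i j :
  ((i, j) \in D) = (i < size la) && (j < nth 0 la i).
Proof. by rewrite mem_skew_diagram nth0_nil. Qed.

Lemma row_le_entry (T : {ffun seq_sub D -> 'I_n}) x :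
  ssyt (@cell_row D) (@cell_col D) T -> cell_row x <= T x.
Proof.
case/ssytP=> _ T_col; move: {-2}(cell_row x) (erefl (cell_row x)) => r.
elim: r x => // r IHr [[i j] /= hx] /=; rewrite {1}/cell_row /= => ri.
have hy : (r, j) \in D.
  move: hx; rewrite !mem_young_diagram -ri.
  by have := is_part_anti la_part (leqnSn r); lia.
have le_ry := IHr (SeqSub hy) erefl.
apply: leq_ltn_trans le_ry (T_col _ _ _ _) => //.
by rewrite /cell_row /= -ri.
Qed.

Lemma content_rows (T : {ffun seq_sub D -> 'I_n}) a :
  (forall x, T x = cell_row x :> nat) -> content T a = nth 0 la a.
Proof.
move=> T_row; transitivity (count (fun b => b.1 == a :> nat) D).
  rewrite -(card_cells (fun b => b.1 == a :> nat)) ?skew_diagram_uniq //.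
  by apply: eq_card => x; rewrite !inE -val_eqE /= T_row.
by rewrite count_row nth0_nil subn0.
Qed.

(** Strict columns give [cell_row x <= T x] and the lattice condition gives the converse. The
    filling is therefore by row indices, and its content is [la]. *)
Lemma schur_coef_young_neq nu : is_part nu -> size nu <= n -> nu != la ->
  schur_coef (nth 0 nu) (schur n D) = 0%R.
Proof.
move=> nu_part nu_n ne; apply/eqP/negPn/negP.
move=> /(schur_coefP _ (is_part_anti nu_part) (young_convex la_part)).
case=> T [/andP[T_ssyt /forallP T_nu] T_lat]; case/eqP: ne.
apply: (eq_part nu_part la_part nu_n la_n) => a an.
rewrite -(eqP (T_nu (Ordinal an))); apply: content_rows => x.
apply/eqP; rewrite eqn_leq row_le_entry // andbT.
apply: (entry_le_row (@cell_coord_inj D) (young_convex la_part) T_ssyt).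
by move=> y; exact: T_lat.
Qed.

Lemma schur_coef_young_eq : schur_coef (nth 0 la) (schur n D) != 0%R.
Proof.
apply/(schur_coefP _ (is_part_anti la_part) (young_convex la_part)).
have lt_row (b : seq_sub D) : cell_row b < n.
  case: b => -[i j] hb; rewrite /cell_row /=.
  by move: hb; rewrite mem_young_diagram; lia.
pose T : {ffun seq_sub D -> 'I_n} := [ffun b => Ordinal (lt_row b)].
have T_row x : T x = cell_row x :> nat by rewrite ffunE.
exists T; split.
  apply/andP; split; last by apply/forallP => a; rewrite content_rows.
  by apply/ssytP; split=> x y; rewrite !T_row // => ->.
move=> j; apply/'forall_forallP => a b; apply/implyP => /eqP ba.
have cE c : content_from (@cell_col D) j T c =
    count (fun b => (b.1 == c :> nat) && (j <= b.2)) D.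
  rewrite -(card_cells (fun b => (b.1 == c :> nat) && (j <= b.2)));
    last exact: skew_diagram_uniq.
  by apply: eq_card => x; rewrite !inE -val_eqE /= T_row.
(* Moving each cell of row [b] up by one row within its column injects the tail cells of row [b]
   into those of row [a]. *)
rewrite !cE -!size_filter -(size_map (fun b => (b.1.-1, b.2))).
apply: uniq_leq_size => [|_ /mapP[[i k] + ->]].
  rewrite map_inj_in_uniq ?filter_uniq ?skew_diagram_uniq //.
  move=> [i k] [i' k']; rewrite !mem_filter /=.
  by move=> /andP[/andP[/eqP-> _] _] /andP[/andP[/eqP-> _] _] [->].
rewrite !mem_filter /= !mem_young_diagram => /andP[/andP[/eqP-> ->]].
rewrite ba /= eqxx /=; have := is_part_anti la_part (leqnSn a).
by lia.
Qed.

End YoungDiagram.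

(** Applied to the Schur expansion, the functional isolates the term of [nu]. With [size D]
    variables, every partition of [size D] has at most as many parts as there are variables. *)
Lemma lr_filling_exists D c nu :
  convex_cells (@cell_row D) (@cell_col D) -> LR_coefficients D c ->
  is_part nu -> sumn nu = size D -> c nu != 0%R ->
  exists T : {ffun seq_sub D -> 'I_(size D)},
    [/\ ssyt (@cell_row D) (@cell_col D) T,
        forall a, content T a = nth 0 nu a
      & forall j, lattice_from (@cell_col D) j T].
Proof.
move=> D_convex /(_ (size D)) D_LR nu_part nu_sum c_nu.
suff : schur_coef (nth 0 nu) (schur (size D) D) != 0%R.
  case/(schur_coefP _ (is_part_anti nu_part) D_convex) => T.
  case=> /andP[T1 /forallP T2] T3.
  by exists T; split=> // a; apply/eqP.
rewrite D_LR schur_coef_sum (bigD1_seq nu) ?uniq_partitions //=; last first.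
  by rewrite mem_partitions nu_part nu_sum eqxx.
have nu_n : size nu <= size D by rewrite -nu_sum is_part_size.
rewrite big1_seq ?addr0 => [|mu /andP[ne]].
  by rewrite mulf_neq0 // schur_coef_young_eq.
rewrite mem_partitions => /andP[mu_part /eqP mu_sum].
by rewrite schur_coef_young_neq ?mulr0 // -?mu_sum ?is_part_size // eq_sym.
Qed.

(** * Ribbons *)

Lemma perm_rearrange al (pi : 'S_(size al)) : perm_eq (rearrange al pi) al.
Proof.
have {2}-> : al = map (fun i : 'I_(size al) => nth 0 al i) (enum 'I_(size al)).
  by rewrite -[LHS](mkseq_nth 0) /mkseq -val_enum_ord -map_comp.
rewrite /rearrange (map_comp (fun i : 'I_(size al) => nth 0 al i) pi).
apply: perm_map; apply: uniq_perm; rewrite ?enum_uniq //.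
  by rewrite map_inj_uniq ?enum_uniq //; exact: perm_inj.
move=> i; rewrite mem_enum; apply/mapP; exists (pi^-1%g i).
  by rewrite mem_enum.
by rewrite permKV.
Qed.

(** * Ranking the rows by length *)

Section RowRanks.

Variable be : seq nat.

(** The total, reflexive form of the ranking, as sorting requires; [ranked_rows] then runs from the
    largest row to the smallest. *)
Definition row_ge (k l : nat) : bool := ~~ row_smaller be k l.

Definition ranked_rows : seq nat := sort row_ge (iota 0 (size be)).

Lemma row_geE k l : row_ge k l =
  (nth 0 be l < nth 0 be k) || ((nth 0 be l == nth 0 be k) && (k <= l)).
Proof. rewrite /row_ge /row_smaller; lia. Qed.

Lemma row_ge_trans : transitive row_ge.
Proof. by move=> b a c; rewrite !row_geE; lia. Qed.

Lemma size_ranked_rows : size ranked_rows = size be.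
Proof. by rewrite size_sort size_iota. Qed.

Lemma perm_ranked_rows : perm_eq ranked_rows (iota 0 (size be)).
Proof. by rewrite perm_sort. Qed.

Lemma ranked_rows_ge p q : p < q -> q < size be ->
  row_ge (nth 0 ranked_rows p) (nth 0 ranked_rows q)
  && ~~ row_ge (nth 0 ranked_rows q) (nth 0 ranked_rows p).
Proof.
move=> pq qn; have srt : sorted row_ge ranked_rows.
  by apply: sort_sorted => a b; rewrite !row_geE; lia.
have h : row_ge (nth 0 ranked_rows p) (nth 0 ranked_rows q).
  apply: (sorted_ltn_nth row_ge_trans 0 srt) => //;
    rewrite inE size_ranked_rows //.
  by lia.
have ne : nth 0 ranked_rows p != nth 0 ranked_rows q.
  rewrite nth_uniq ?size_ranked_rows ?sort_uniq ?iota_uniq //; lia.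
by move: h ne; rewrite !row_geE; lia.
Qed.

Lemma rank_ranked_row q : q < size be ->
  count (fun k => row_smaller be k (nth 0 ranked_rows q)) (iota 0 (size be))
  = size be - q.+1.
Proof.
move=> qn; rewrite -(seq.permP perm_ranked_rows) -sum1_count (big_nth 0).
rewrite size_ranked_rows (big_cat_nat (n := q.+1)) //=.
rewrite big_nat_cond big1 => [|p /andP[pq]].
  rewrite add0n big_nat_cond (eq_bigl (fun p => q.+1 <= p < size be)) => [|p].
    by rewrite -big_nat sum_nat_const_nat muln1.
  apply: andb_idr => /andP[qp pn].
  by have /andP[_] := ranked_rows_ge qp pn; rewrite /row_ge negbK.
have [->|ne] := eqVneq p q; first by rewrite /row_smaller; lia.
have pq' : p < q by lia.
by have /andP[+ _] := ranked_rows_ge pq' qn; rewrite /row_ge => /negbTE->.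
Qed.

(** Position [q] in the ranking has [size be - q.+1] smaller rows, so the chosen rows are those at
    positions [i] and later. *)
Lemma sum_among_smallest i (F : nat -> nat) : i <= size be ->
  \sum_(r <- iota 0 (size be) | among_smallest be (size be - i) r) F r =
  \sum_(i <= q < size be) F (nth 0 ranked_rows q).
Proof.
move=> il; rewrite -(perm_big _ perm_ranked_rows) /= (big_nth 0).
rewrite size_ranked_rows (big_cat_nat (n := i)) //=.
have asE q : q < size be ->
    among_smallest be (size be - i) (nth 0 ranked_rows q) = (i <= q).
  by move=> qn; rewrite /among_smallest rank_ranked_row //; lia.
rewrite big_nat_cond big1 => [|p /andP[pi]]; last by rewrite asE; lia.
rewrite add0n [LHS]big_nat_cond [RHS]big_nat.
by apply: eq_bigl => q; apply: andb_idr => /andP[iq qn]; rewrite asE.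
Qed.

(** This is the level below the last row; with it, [count_above_level] speaks about the letter [i]
    in the whole ribbon. *)
Lemma count_not_smallest i : i <= size be ->
  count (predC (among_smallest be (size be - i))) (iota 0 (size be)) = i.
Proof.
move=> il.
have := count_predC (among_smallest be (size be - i)) (iota 0 (size be)).
rewrite -{1}sum1_count sum_among_smallest // sum_nat_const_nat size_iota.
by lia.
Qed.

(** Both sides are weakly decreasing rearrangements of the same parts, so ties do not matter. *)
Lemma map_ranked_rows al : is_part al -> perm_eq be al ->
  map (nth 0 be) ranked_rows = al.
Proof.
move=> /andP[al_sorted _] be_al.
apply: (sorted_eq (leT := geq)) => //.
- exact: rev_trans leq_trans.
- by move=> a b; rewrite andbC; exact: anti_leq.
- rewrite sorted_map; apply: (sub_sorted (e := row_ge)).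
    by move=> k l /=; rewrite row_geE; lia.
  by apply: sort_sorted => a b; rewrite !row_geE; lia.
apply: perm_trans be_al; rewrite -[X in perm_eq _ X](mkseq_nth 0).
by apply: perm_map; exact: perm_ranked_rows.
Qed.

Lemma sum_smallest_rows al i : is_part al -> perm_eq be al -> i <= size be ->
  \sum_(r <- iota 0 (size be) | among_smallest be (size be - i) r) nth 0 be r =
  \sum_(i <= q < size al) nth 0 al q.
Proof.
move=> al_part be_al il; rewrite sum_among_smallest // -(perm_size be_al).
apply: eq_big_nat => q /andP[_ qn].
by rewrite -(map_ranked_rows al_part be_al) (nth_map 0) // size_ranked_rows.
Qed.

End RowRanks.

(** * Coordinates of the ribbon *)

Section RibbonShape.

Variable be : seq nat.
Hypothesis be_gt0 : forall x : nat, x \in be -> 0 < x.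

Lemma size_ribbon_outer : size (ribbon_outer be) = size be.
Proof. by rewrite size_map size_iota. Qed.

Lemma nth_ribbon_outer r : r < size be ->
  nth 0 (ribbon_outer be) r = sumn (drop r be) - (size be - r.+1).
Proof. by move=> rn; rewrite (nth_map 0) ?size_iota // nth_iota. Qed.

Lemma nth_ribbon_inner r :
  nth 0 (ribbon_inner be) r = (nth 0 (ribbon_outer be) r.+1).-1.
Proof.
rewrite /ribbon_inner -nth_behead.
have [h|h] := ltnP r (size (behead (ribbon_outer be))).
  by rewrite (nth_map 0).
by rewrite !nth_default // size_map.
Qed.

(** It makes the truncated subtractions in [ribbon_outer] exact and the end of every row
    positive. *)
Lemma sumn_drop_ge r : size be - r <= sumn (drop r be).
Proof.
rewrite -size_drop; have : forall x, x \in drop r be -> 0 < x.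
  by move=> x /mem_drop/be_gt0.
elim: (drop r be) => //= x s IHs pos.
have := pos x (mem_head _ _).
have : size s <= sumn s by apply: IHs => y ys; rewrite pos // inE ys orbT.
by lia.
Qed.

Lemma ribbon_outer_step r : r < size be ->
  nth 0 (ribbon_outer be) r =
  nth 0 be r + (nth 0 (ribbon_outer be) r.+1).-1.
Proof.
move=> rn; rewrite nth_ribbon_outer // (drop_nth 0 rn) /=.
have [rn'|nr] := ltnP r.+1 (size be).
  by rewrite nth_ribbon_outer //; have := sumn_drop_ge r.+1; lia.
(* Below the last row the default [0] has predecessor [0], the column where the last row starts. *)
rewrite drop_oversize //= [nth 0 (ribbon_outer be) _]nth_default;
  last by rewrite size_ribbon_outer.
by lia.
Qed.

Lemma ribbon_row_length r : r < size be ->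
  nth 0 (ribbon_outer be) r - nth 0 (ribbon_inner be) r = nth 0 be r.
Proof. by move=> rn; rewrite ribbon_outer_step // nth_ribbon_inner addnK. Qed.

Lemma ribbon_outer_anti a b : a <= b ->
  nth 0 (ribbon_outer be) b <= nth 0 (ribbon_outer be) a.
Proof.
have step r : nth 0 (ribbon_outer be) r.+1 <= nth 0 (ribbon_outer be) r.
  have [rn|nr] := ltnP r (size be).
    have be_r : 0 < nth 0 be r := be_gt0 (mem_nth 0 rn).
    by rewrite (ribbon_outer_step rn); lia.
  by rewrite nth_default ?size_ribbon_outer //; lia.
elim: b => [|b IHb]; first by rewrite leqn0 => /eqP->.
rewrite leq_eqVlt => /orP[/eqP-> //|ab].
exact: leq_trans (step b) (IHb ab).
Qed.

Lemma ribbon_convex :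
  convex_cells (@cell_row (ribbon be)) (@cell_col (ribbon be)).
Proof.
apply: skew_diagram_convex; first exact: ribbon_outer_anti.
move=> a b ab; rewrite !nth_ribbon_inner.
have : a.+1 <= b.+1 by [].
by move/ribbon_outer_anti; lia.
Qed.

Lemma count_ribbon_rows (q : pred nat) :
  count (fun b => q b.1) (ribbon be) =
  \sum_(r <- iota 0 (size be) | q r) nth 0 be r.
Proof.
rewrite count_rows size_ribbon_outer big_seq_cond [RHS]big_seq_cond.
apply: eq_bigr => r; rewrite mem_iota => /andP[rn _].
by rewrite ribbon_row_length.
Qed.

Lemma size_ribbon : size (ribbon be) = sumn be.
Proof.
rewrite -count_predT (count_ribbon_rows xpredT) sumnE.
by rewrite [RHS](big_nth 0) /index_iota subn0.
Qed.

End RibbonShape.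

(* The two cells of such a column lie on the same level but carry distinct
   letters. *)
Lemma column_off_level D n (T : {ffun seq_sub D -> 'I_n}) (S : pred nat) j :
  uniq D -> convex_cells (@cell_row D) (@cell_col D) ->
  ssyt (@cell_row D) (@cell_col D) T ->
  size (column D j) = 2 -> all (fun b => S b.1) (column D j) ->
  exists x, [/\ S (cell_row x), T x != level S (cell_row x) :> nat
               & cell_col x = j].
Proof.
move=> D_uniq D_convex /ssytP[_ T_col].
have adjacent (x y : seq_sub D) : cell_col x = j -> cell_col y = j ->
    cell_row x < cell_row y -> S (cell_row x) -> S (cell_row y) ->
    (forall z : seq_sub D, cell_col z = j -> z = x \/ z = y) ->
    exists x, [/\ S (cell_row x), T x != level S (cell_row x) :> nat
                & cell_col x = j].
  move=> cx cy lt_xy Sx Sy only_xy.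
  have ry : cell_row y = (cell_row x).+1.
    have [||z rz cz] := D_convex x y (cell_row x).+1 j; [by lia | by lia |].
    by case: (only_xy z cz) => e; move: rz; rewrite e; lia.
  have T_xy : T x < T y by apply: T_col; rewrite // cx cy.
  have ley : level S (cell_row y) = level S (cell_row x).
    by rewrite ry levelS Sx addn0.
  have [e|ne] := eqVneq (T x : nat) (level S (cell_row x)); last by exists x.
  by exists y; split; rewrite // ley -e; lia.
have memC b : (b \in column D j) = (b.2 == j) && (b \in D).
  by rewrite mem_filter.
have : uniq (column D j) by rewrite filter_uniq.
case E : (column D j) => [|b1 [|b2 [|]]] //= + _ /and3P[S1 S2 _].
rewrite inE andbT => ne.
have := memC b1; have := memC b2; rewrite E !inE !eqxx orbT /=.
move=> /esym/andP[/eqP c2 h2] /esym/andP[/eqP c1 h1].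
have only12 (z : seq_sub D) : cell_col z = j -> z = SeqSub h1 \/ z = SeqSub h2.
  move=> cz; have := memC (val z).
  rewrite (valP z) -/(cell_col z) cz eqxx E !inE.
  by case/orP=> /eqP e; [left|right]; apply: val_inj.
have [lt12|lt21|e12] := ltngtP b1.1 b2.1.
- exact: (adjacent (SeqSub h1) (SeqSub h2)).
- apply: (adjacent (SeqSub h2) (SeqSub h1)) => // z /only12.
  by case; [right|left].
- case/eqP: ne.
  by rewrite (surjective_pairing b1) e12 c1 -c2 -surjective_pairing.
Qed.

Lemma lr_ribbon_bound be n (T : {ffun seq_sub (ribbon be) -> 'I_n})
    i (a : 'I_n) :
  (forall x : nat, x \in be -> 0 < x) ->
  ssyt (@cell_row (ribbon be)) (@cell_col (ribbon be)) T ->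
  (forall j, lattice_from (@cell_col (ribbon be)) j T) ->
  i < size be -> a = i :> nat ->
  content T a + nth 0 (overlapping_partition be) i <=
  \sum_(r <- iota 0 (size be) | among_smallest be (size be - i) r) nth 0 be r.
Proof.
move=> be_gt0 T_ssyt T_lat i_n a_i; set S := among_smallest be (size be - i).
have D_uniq : uniq (ribbon be) by exact: skew_diagram_uniq.
have D_convex := ribbon_convex be_gt0.
have row_lt (x : seq_sub (ribbon be)) : cell_row x < size be.
  case: x => -[r c] hx; rewrite /cell_row /=; move: hx.
  by rewrite mem_skew_diagram size_ribbon_outer => /andP[].
rewrite -count_ribbon_rows // -(card_cells (fun b => S b.1)) //.
(* The boxes of [S] whose letter is their level pay for the content, the other boxes of [S] for
   [p_i]. *)
rewrite -(cardsID [set x | T x == level S (cell_row x) :> nat]); apply: leq_add.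
  have := count_above_level (@cell_coord_inj _) D_convex T_ssyt
    (fun x => T_lat _) S (size be).
  rewrite /level count_not_smallest ?(ltnW i_n) // => h.
  apply: leq_trans (leq_trans h _).
    apply/subset_leq_card/subsetP => x; rewrite !inE => /eqP->.
    by rewrite a_i eqxx row_lt.
  apply/subset_leq_card/subsetP => x; rewrite !inE.
  by case/and3P=> Sx _ Tx; apply/andP.
rewrite (nth_map 0) ?size_iota // nth_iota // add0n -size_filter.
(* The columns counted by [p_i] are distinct, and each is the column of some box of [S] off its
   level. *)
rewrite cardE -(size_map (@cell_col _)); apply: uniq_leq_size.
  by rewrite filter_uniq ?undup_uniq.
move=> j; rewrite mem_filter => /andP[/andP[/eqP sz2 Sj] _].
have [x [Sx Tx <-]] := column_off_level D_uniq D_convex T_ssyt sz2 Sj.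
by apply: map_f; rewrite mem_enum !inE Tx.
Qed.

Theorem theorem7p1 (al : seq nat) (al_part : is_part al)
    (al_ge2 : forall x : nat, x \in al -> 2 <= x)
    (pi : 'S_(size al)) (c : seq nat -> int)
    (c_LR : LR_coefficients (ribbon (rearrange al pi)) c)
    (nu : seq nat)
    (nu_interval : dom_interval al
       [:: sumn al - size al + 1; size al - 1] nu)
    (c_gt0 : (0 < c nu)%R) (i : nat)
    (i_lt : i < plength (overlapping_partition (rearrange al pi))) :
  ((nth 0%N nu i)%:Z
   <= (\sum_(i <= q < size al) nth 0%N al q)%N%:Z
      - (nth 0%N (overlapping_partition (rearrange al pi)) i)%:Z)%R.
Proof.
have be_al := perm_rearrange pi; set be := rearrange al pi in c_LR i_lt be_al *.
have be_gt0 x : x \in be -> 0 < x.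
  by rewrite (perm_mem be_al) => /al_ge2/ltnW.
have i_n : i < size be.
  apply: leq_trans i_lt (leq_trans (count_size _ _) _).
  by rewrite size_map size_iota.
have [nu_part [nu_sum _] _] := nu_interval.
have size_be : size (ribbon be) = sumn al.
  by rewrite size_ribbon //; exact: perm_sumn.
have [||T [T_ssyt T_nu T_lat]] :=
    lr_filling_exists (ribbon_convex be_gt0) c_LR nu_part.
- by rewrite size_be nu_sum.
- exact: Num.Theory.lt0r_neq0.
(* The letter [i] must belong to the alphabet, whose size is the number of boxes; there are at most
   that many rows. *)
have i_D : i < size (ribbon be).
  rewrite size_be; apply: leq_trans i_n _.
  by rewrite (perm_size be_al); exact: is_part_size.
have := lr_ribbon_bound (a := Ordinal i_D) be_gt0 T_ssyt T_lat i_n erefl.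
rewrite T_nu (sum_smallest_rows al_part be_al (ltnW i_n)) /=.
by lia.
Qed.
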